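(* Let $k\ge 2$, let $\pi\in S_k$, let $A\subseteq\{1,\dots,k-1\}$, and let $j=k-|A|$ be the number of blocks of the vincular pattern $(\pi,A)$. For each $n$ let $\sigma_n$ be a uniformly random element of $S_n$ and let $X^{(\pi,A)}(\sigma_n)$ be the number of occurrences of $(\pi,A)$ in $\sigma_n$. Then there exist $C>0$ and $n_0$ such that for all $n\ge n_0$, $$\operatorname{Var}\bigl(X^{(\pi,A)}(\sigma_n)\bigr)\ge C\,n^{2j-1}.$$
   Context: $S_n$ is the set of permutations of $\{1,\dots,n\}$, written in one-line notation $\sigma=\sigma_1\sigma_2\dots\sigma_n$. A vincular pattern of size $k$ is a pair $(\pi,A)$ with $\pi\in S_k$ and $A\subseteq\{1,\dots,k-1\}$; its number of blocks is $j=k-|A|$. An occurrence of $(\pi,A)$ in $\sigma\in S_n$ is a subsequence $\sigma_{i_1}\sigma_{i_2}\dots\sigma_{i_k}$ with $i_1<i_2<\dots<i_k$ (identified with its set of positions $\{i_1,\dots,i_k\}$) such that (i) for all $r,s\in\{1,\dots,k\}$, $\pi_r<\pi_s \iff \sigma_{i_r}<\sigma_{i_s}$; and (ii) $i_{a+1}=i_a+1$ for all $a\in A$. *)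

(* Defs.v *)
From mathcomp Require Import all_boot all_order all_algebra all_fingroup.
From mathcomp Require Import reals.

Set Implicit Arguments.
Unset Strict Implicit.
Unset Printing Implicit Defensive.

Import Order.TTheory GRing.Theory Num.Theory.

(* Positions and values are numbered from 0: 'S_n permutes {0, ..., n-1}, and
   the element a of {1, ..., k-1} in the mathematical notation is represented
   by a - 1 in 'I_k.-1.  Thus a : 'I_k.-1 belongs to A when the entries of the
   pattern with 0-based indices a and a + 1 must be adjacent. *)

Definition num_blocks (k : nat) (A : {set 'I_k.-1}) : nat := (k - #|A|)%N.

(* A set of k positions i_1 < ... < i_k in {0, ..., n-1} is encoded by its
   unique increasing enumeration i : 'I_k -> 'I_n. *)
Definition is_occurrence (k n : nat) (pi : 'S_k) (A : {set 'I_k.-1})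
    (sigma : 'S_n) (i : {ffun 'I_k -> 'I_n}) : bool :=
  [&& [forall r : 'I_k, forall s : 'I_k, (r < s)%N ==> (i r < i s)%N],
      [forall r : 'I_k, forall s : 'I_k,
         (pi r < pi s)%N == (sigma (i r) < sigma (i s))%N]
    & [forall a in A, forall r : 'I_k, forall s : 'I_k,
         ((r == a :> nat) && (s == a.+1 :> nat)) ==> (i s == (i r).+1 :> nat)]].

Definition num_occurrences (k n : nat) (pi : 'S_k) (A : {set 'I_k.-1})
    (sigma : 'S_n) : nat :=
  #|[set i : {ffun 'I_k -> 'I_n} | is_occurrence pi A sigma i]|.

Local Open Scope ring_scope.

(* Expectation and variance of f(x) for x uniformly distributed on T. *)
Definition unif_expectation (R : realType) (T : finType) (f : T -> R) : R :=
  (\sum_(x : T) f x) / #|T|%:R.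

Definition unif_variance (R : realType) (T : finType) (f : T -> R) : R :=
  unif_expectation (fun x => (f x - unif_expectation f) ^+ 2).

(* Main.v *)
Require Import Defs.
From mathcomp Require Import all_boot all_order all_algebra all_fingroup.
From mathcomp Require Import reals.
From mathcomp Require Import zify ring lra.

(* If E[Y] = 0, E[Y^2] <= V and |E[X Y]| >= w, then Var X >= w^2 / V; we exhibit
   a test statistic Y with V of order n and w of order n^j.

   If j >= 2, Y counts, up to centering, the positions m < M with value < D,
   where M and D are small fixed fractions of n.  Conditionally on the pattern
   formed by the entries at some k positions, values at other positions remain
   uniform; having a value < D is negatively correlated with being a non-minimal
   entry of the pattern, and these correlations sum to zero over the pattern.
   Hence the first block has a total correlation of definite sign, and
   occurrences with exactly their first block among the positions < M dominate.

   If j = 1, cut the positions into windows of length 3k.  Y is the number of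
   windows on which sigma is increasing, minus the number of windows on which it
   is an increasing sequence whose middle k entries have been rearranged by a
   fixed permutation: pi itself, or a transposition if pi is the identity.
   Distinct windows are uncorrelated, and permuting the middle of an increasing
   window changes the number of occurrences always in the same direction. *)

Set Implicit Arguments.
Unset Strict Implicit.
Unset Printing Implicit Defensive.

Import Order.TTheory GRing.Theory Num.Theory.
Local Open Scope ring_scope.

(** * Lower bound for a variance through a test statistic *)

(** Sum the inequality [(f x - mu - t * Y x) ^+ 2 >= 0] over [x]: the term in [mu] vanishes because
    [Y] has mean zero, and a suitable [t] gives the bound. *)
Lemma unif_variance_ge (R : realType) (T : finType) (f Y : T -> R) (w V : R) :
  (0 < #|T|)%N -> 0 < V -> 0 <= w ->
  \sum_x Y x = 0 -> \sum_x Y x ^+ 2 <= #|T|%:R * V ->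
  #|T|%:R * w <= `|\sum_x f x * Y x| ->
  w ^+ 2 / V <= unif_variance f.
Proof.
move=> T0 V0 w0 Y0 YV fYw; set N : R := #|T|%:R.
have N0 : 0 < N by rewrite ltr0n.
rewrite /unif_variance {1}/unif_expectation ler_pdivlMr //.
set mu := unif_expectation f; set S := \sum_x f x * Y x in fYw.
pose s : R := if 0 <= S then 1 else -1.
have sS : s * S = `|S|.
  rewrite /s; case: ifP => [S0|]; first by rewrite mul1r ger0_norm.
  by move/negbT; rewrite -ltNge => S0; rewrite mulN1r ltr0_norm.
have s2 : s ^+ 2 = 1 by rewrite /s; case: ifP; rewrite ?sqrrN expr1n.
(* [w / V] maximizes [2 * t * w - t ^+ 2 * V]; the sign [s] makes the covariance count
   positively. *)
pose t := s * (w / V).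
have le_sq x : 2 * t * (f x * Y x) - 2 * t * mu * Y x - t ^+ 2 * Y x ^+ 2
    <= (f x - mu) ^+ 2.
  rewrite -subr_ge0; set z := (X in 0 <= X).
  have -> : z = (f x - mu - t * Y x) ^+ 2 by rewrite /z; ring.
  exact: sqr_ge0.
apply: le_trans (ler_sum _ (fun x _ => le_sq x)).
rewrite !sumrB -!mulr_sumr Y0 mulr0 subr0 -/S.
have -> : 2 * t * S = 2 * (w / V) * `|S| by rewrite -sS /t; ring.
have -> : t ^+ 2 = (w / V) ^+ 2 by rewrite /t exprMn s2 mul1r.
have wV0 : 0 <= w / V by rewrite divr_ge0 // ltW.
have h1 : 2 * (w / V) * (N * w) <= 2 * (w / V) * `|S|.
  by rewrite ler_wpM2l // mulr_ge0.
have h2 : (w / V) ^+ 2 * (\sum_x Y x ^+ 2) <= (w / V) ^+ 2 * (N * V).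
  by rewrite ler_wpM2l // exprn_ge0.
have -> : w ^+ 2 / V * N = 2 * (w / V) * (N * w) - (w / V) ^+ 2 * (N * V).
  by field; rewrite gt_eqF.
exact: lerB.
Qed.

(** * Patterns formed by the entries at given positions *)

Lemma card_ord_lt (n M : nat) : (M <= n)%N -> #|[set v : 'I_n | (v < M)%N]| = M.
Proof.
move=> le_Mn; rewrite -[RHS]card_ord.
have inj_w : injective (widen_ord le_Mn).
  by move=> x y /(congr1 val) /= e; apply: val_inj.
rewrite -(card_imset _ inj_w); apply: eq_card => v; rewrite !inE.
apply/idP/imsetP => [lt_vM|[u _ ->] /=]; last exact: ltn_ord.
by exists (Ordinal lt_vM) => //; apply: val_inj.
Qed.

(** Recovers the values of a permutation from comparisons alone, which makes the pattern at given
    positions unique. *)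
Lemma perm_rank (k : nat) (pi : 'S_k) (r : 'I_k) :
  #|[set s | (pi s < pi r)%N]| = pi r.
Proof.
rewrite -[RHS](@card_ord_lt k (pi r)); last exact/ltnW/ltn_ord.
rewrite -(card_imset _ (@perm_inj _ pi)).
apply: eq_card => v; rewrite inE; apply/imsetP/idP => [[s]|lt_v].
  by rewrite inE => ? ->.
by exists (pi^-1 v)%g; rewrite ?inE permKV.
Qed.

Section Matches.

Variables (k n : nat).
Implicit Types (pi rho : 'S_k) (sigma h : 'S_n) (i : 'I_k -> 'I_n).

(** The order condition of an occurrence, freed from the conditions on positions; [i] is any map, so
    it applies to whole windows as well. *)
Definition matches pi sigma i :=
  [forall r, forall s, (pi r < pi s)%N == (sigma (i r) < sigma (i s))%N].

Lemma matchesP pi sigma i :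
  reflect (forall r s, (pi r < pi s)%N = (sigma (i r) < sigma (i s))%N)
          (matches pi sigma i).
Proof.
apply: (iffP forallP) => [H r s|H r]; last by apply/forallP => s; rewrite H.
by have /forallP/(_ s)/eqP := H r.
Qed.

Lemma matches_uniq pi rho sigma i :
  matches pi sigma i -> matches rho sigma i -> pi = rho.
Proof.
move=> /matchesP Hpi /matchesP Hrho; apply/permP => r; apply: val_inj => /=.
rewrite -(perm_rank pi r) -(perm_rank rho r).
by apply: eq_card => s; rewrite !inE Hpi Hrho.
Qed.

(** The pattern is the rank function: sending [r] to the number of chosen entries below that at
    [i r] is strictly monotone in the entries, hence injective. *)
Lemma matches_exists sigma i : injective i -> exists pi, matches pi sigma i.
Proof.
move=> i_inj.
pose below r := [set s | (sigma (i s) < sigma (i r))%N].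
have rank_lt r : (#|below r| < k)%N.
  rewrite -[X in (_ < X)%N]card_ord -cardsT; apply: proper_card.
  by apply/properP; split; [exact: subsetT | exists r; rewrite inE ?ltnn].
pose f r := Ordinal (rank_lt r).
have f_mono r s : (sigma (i r) < sigma (i s))%N -> (f r < f s)%N.
  move=> lt_rs; apply: proper_card; apply/properP; split.
    by apply/subsetP => t; rewrite !inE => /ltn_trans; apply.
  by exists r; rewrite inE ?ltnn.
have f_inj : injective f.
  move=> r s /(congr1 val) /= frs; apply: i_inj; apply: (@perm_inj _ sigma).
  apply: val_inj; case: (ltngtP (sigma (i r)) (sigma (i s))) => // /f_mono /=.
    by rewrite frs ltnn.
  by rewrite frs ltnn.
exists (perm f_inj); apply/matchesP => r s; rewrite !permE.
apply/idP/idP; last exact: f_mono.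
apply: contraLR; rewrite -!leqNgt leq_eqVlt => /predU1P[e|/f_mono /ltnW //].
by have /perm_inj/i_inj-> := val_inj e.
Qed.

Lemma sum_matches (R : pzSemiRingType) sigma i :
  injective i -> \sum_pi (matches pi sigma i)%:R = 1 :> R.
Proof.
move=> i_inj; have [pi m_pi] := matches_exists sigma i_inj.
rewrite (bigD1 pi) //= m_pi big1 ?addr0 // => rho ne_rho.
case: (boolP (matches rho sigma i)) => // m_rho.
by rewrite (matches_uniq m_rho m_pi) eqxx in ne_rho.
Qed.

(** In [h * sigma] the factor [h] acts first, so left multiplication by such an [h] rearranges the
    entries at the positions [i] and no others. *)
Lemma extend_perm i rho : injective i ->
  exists h, (forall r, h (i r) = i (rho r)) /\
            (forall x, x \notin codom i -> h x = x).
Proof.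
move=> i_inj.
pose f x := if [pick r | i r == x] is Some r then i (rho r) else x.
have fi r : f (i r) = i (rho r).
  by rewrite /f; case: pickP => [s /eqP/i_inj->//|/(_ r)]; rewrite eqxx.
have fx x : x \notin codom i -> f x = x.
  by rewrite /f; case: pickP => // r /eqP<-; rewrite codom_f.
have f_codom x : x \in codom i -> f x \in codom i.
  by move=> /codomP[r ->]; rewrite fi codom_f.
have f_inj : injective f.
  move=> x y; case: (boolP (x \in codom i)); case: (boolP (y \in codom i)).
  - by move=> /codomP[r ->] /codomP[s ->]; rewrite !fi => /i_inj/perm_inj->.
  - by move=> Ny /f_codom + e; rewrite e fx // (negbTE Ny).
  - by move=> /f_codom + Nx e; rewrite -e fx // (negbTE Nx).
  - by move=> Ny Nx; rewrite !fx.
by exists (perm f_inj); split=> [r|x /fx]; rewrite permE.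
Qed.

(* Precomposing sigma with permutations supported on the range of i permutes
   the k! patterns simply transitively and does not change g. *)
Lemma sum_matches_mul (R : numFieldType) pi i (g : 'S_n -> R) : injective i ->
  (forall h sigma, (forall x, x \notin codom i -> h x = x) ->
     g (h * sigma)%g = g sigma) ->
  \sum_sigma (matches pi sigma i)%:R * g sigma = (\sum_sigma g sigma) / k`!%:R.
Proof.
move=> i_inj g_inv.
have same rho : \sum_sigma (matches rho sigma i)%:R * g sigma =
                \sum_sigma (matches pi sigma i)%:R * g sigma.
  (* For this [h], [h * sigma] has pattern [pi] at [i] exactly when [sigma] has pattern [rho]
     there. *)
  have [h [hi hx]] := extend_perm (pi * rho^-1)%g i_inj.
  rewrite [RHS](reindex_inj (mulgI h)) /=; apply: eq_bigr => sigma _.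
  rewrite g_inv //; congr (_%:R * _); congr nat_of_bool.
  apply/matchesP/matchesP => H r s.
    by rewrite !permM !hi -H !permM !permKV.
  have := H (pi^-1 (rho r))%g (pi^-1 (rho s))%g.
  by rewrite !permM !hi !permM !permKV !permK.
have k0 : k`!%:R != 0 :> R by rewrite pnatr_eq0 -lt0n fact_gt0.
apply: (canRL (mulfK k0)).
(* The sums for the k! patterns are equal, and together they give the sum of [g], since each [sigma]
   matches exactly one pattern. *)
rewrite mulr_natr -card_Sn -sumr_const.
under eq_bigr => rho _ do rewrite -(same rho).
rewrite exchange_big /=; apply: eq_bigr => sigma _.
by rewrite -mulr_suml sum_matches // mul1r.
Qed.

Lemma sum_matches_const (R : numFieldType) pi i : injective i ->
  \sum_sigma (matches pi sigma i)%:R = n`!%:R / k`!%:R :> R.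
Proof.
move=> i_inj.
have := @sum_matches_mul R pi i (fun=> 1) i_inj (fun _ _ _ => erefl).
under eq_bigr => sigma _ do rewrite mulr1.
by move->; rewrite sumr_const card_Sn.
Qed.

End Matches.

(** * Two or more blocks *)

Section CornerStatistic.

Variables (R : realFieldType) (n D M : nat).
Hypotheses (n_gt0 : (0 < n)%N) (le_Dn : (D <= n)%N).

Let delta : R := D%:R / n%:R.
Let nR_gt0 : 0 < n%:R :> R. Proof. by rewrite ltr0n. Qed.
Let nR_neq0 : n%:R != 0 :> R. Proof. by rewrite gt_eqF. Qed.

Definition low_centered (v : 'I_n) : R := (v < D)%N%:R - D%:R / n%:R.

Definition corner_stat (sigma : 'S_n) : R :=
  \sum_(m : 'I_n | (m < M)%N) low_centered (sigma m).

Lemma delta_ge0 : 0 <= delta.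
Proof. by rewrite divr_ge0. Qed.

Lemma delta_le1 : delta <= 1.
Proof. by rewrite ler_pdivrMr // mul1r ler_nat. Qed.

Lemma sqr_low_centered_le1 v : low_centered v ^+ 2 <= 1.
Proof.
have := delta_le1; have := delta_ge0; rewrite /low_centered -/delta.
by case: (v < D)%N => /= ? ?; nra.
Qed.

Lemma sum_low_centered : \sum_v low_centered v = 0.
Proof.
have cardD : (\sum_(v : 'I_n) (v < D)%N)%N = D.
  rewrite -[RHS](card_ord_lt le_Dn) -sum1_card [RHS]big_mkcond /=.
  by apply: eq_bigr => v _; rewrite inE; case: (v < D)%N.
rewrite sumrB sumr_const card_ord -natr_sum cardD.
by rewrite -[X in _ - X]mulr_natr divfK // subrr.
Qed.

Lemma sum_low_centered_perm (sigma : 'S_n) :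
  \sum_x low_centered (sigma x) = 0.
Proof.
by rewrite -[RHS]sum_low_centered [RHS](reindex_inj (@perm_inj _ sigma)).
Qed.

(** By symmetry all positions have the same mean, and for each [sigma] the sum over all positions is
    zero. *)
Lemma mean_low_centered x : \sum_(sigma : 'S_n) low_centered (sigma x) = 0.
Proof.
have same y : \sum_(sigma : 'S_n) low_centered (sigma y) =
              \sum_(sigma : 'S_n) low_centered (sigma x).
  rewrite (reindex_inj (mulgI (tperm x y))) /=.
  by apply: eq_bigr => sigma _; rewrite permM tpermR.
apply: (mulIf nR_neq0); rewrite mul0r mulr_natr -[in X in _ *+ X](card_ord n).
rewrite -sumr_const; under eq_bigr => y _ do rewrite -(same y).
by rewrite exchange_big big1 // => sigma _; exact: sum_low_centered_perm.
Qed.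

(** By symmetry the sum has the same value [S] for every second position other than [x]. Over all
    second positions these sums add up to zero, and position [x] itself contributes a sum of
    squares, so [S] cannot be positive. *)
Lemma low_centered_neg_corr x y : x != y ->
  \sum_(sigma : 'S_n) low_centered (sigma x) * low_centered (sigma y) <= 0.
Proof.
move=> ne_xy; set S := \sum_sigma _.
have same z : z != x ->
    \sum_(sigma : 'S_n) low_centered (sigma x) * low_centered (sigma z) = S.
  move=> ne_zx; rewrite (reindex_inj (mulgI (tperm y z))) /=.
  by apply: eq_bigr => sigma _; rewrite !permM tpermR tpermD // eq_sym.
have tot : \sum_z \sum_(sigma : 'S_n)
    low_centered (sigma x) * low_centered (sigma z) = 0.
  rewrite exchange_big big1 // => sigma _.
  by rewrite -mulr_sumr sum_low_centered_perm mulr0.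
rewrite leNgt; apply/negP => S_gt0; move/eqP: tot; apply/negP.
rewrite gt_eqF // (bigD1 x) //= ltr_wpDl //.
  by apply: sumr_ge0 => sigma _; rewrite -expr2 sqr_ge0.
rewrite (bigD1 y) 1?eq_sym //= ltr_pwDl // sumr_ge0 // => z.
by case/andP => ne_zx _; rewrite same // ltW.
Qed.

Lemma sum_low x : \sum_(sigma : 'S_n) (sigma x < D)%N%:R = n`!%:R * delta.
Proof.
have /eqP := mean_low_centered x; rewrite sumrB sumr_const card_Sn subr_eq0.
by move/eqP->; rewrite [RHS]mulr_natl.
Qed.

(** The negative correlation without centering: two given entries are both low with probability at
    most [delta ^+ 2]. *)
Lemma sum_low2 x y : x != y ->
  \sum_(sigma : 'S_n) (sigma x < D)%N%:R * (sigma y < D)%N%:R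
    <= n`!%:R * delta ^+ 2.
Proof.
move=> ne_xy; rewrite -[leRHS]add0r.
apply: le_trans (lerD (low_centered_neg_corr ne_xy) (lexx _)).
have -> : n`!%:R * delta ^+ 2 = \sum_(sigma : 'S_n) (delta ^+ 2 +
    delta * low_centered (sigma x) + delta * low_centered (sigma y)).
  rewrite !big_split /= sumr_const card_Sn -!mulr_sumr !mean_low_centered.
  by rewrite !mulr0 !addr0 [LHS]mulr_natl.
rewrite -big_split; apply: ler_sum => sigma _ /=.
by rewrite /low_centered -/delta le_eqVlt; apply/orP; left; apply/eqP; ring.
Qed.

Lemma sum_corner_stat : \sum_sigma corner_stat sigma = 0.
Proof. by rewrite exchange_big big1 // => x _; exact: mean_low_centered. Qed.

(** Off-diagonal terms are nonpositive, and each of the at most [n] diagonal terms is at most n!. *)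
Lemma sum_sqr_corner_stat :
  \sum_sigma corner_stat sigma ^+ 2 <= n`!%:R * n%:R.
Proof.
have -> : \sum_sigma corner_stat sigma ^+ 2 =
    \sum_(x : 'I_n | (x < M)%N) \sum_(y : 'I_n | (y < M)%N)
      \sum_(sigma : 'S_n) low_centered (sigma x) * low_centered (sigma y).
  under [RHS]eq_bigr => x _ do rewrite exchange_big.
  rewrite exchange_big /=; apply: eq_bigr => sigma _.
  by rewrite expr2 mulr_suml; apply: eq_bigr => x _; rewrite mulr_sumr.
have -> : n`!%:R * n%:R = \sum_(x : 'I_n) n`!%:R :> R.
  by rewrite sumr_const card_ord mulr_natr.
rewrite [leRHS](bigID (fun x : 'I_n => (x < M)%N)) /= -[leLHS]addr0.
apply: lerD; last exact: sumr_ge0.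
apply: ler_sum => x lt_xM; rewrite (bigD1 x) //= -[leRHS]addr0; apply: lerD.
  rewrite -card_Sn -sumr_const; apply: ler_sum => sigma _.
  by rewrite -expr2 sqr_low_centered_le1.
apply: sumr_le0 => y /andP[_ ne].
by apply: low_centered_neg_corr; rewrite eq_sym.
Qed.

(** * Correlation of the corner statistic with a single placement *)

Section PatternCorrelation.

Variables (k : nat) (pi : 'S_k) (i : 'I_k -> 'I_n).
Hypothesis i_inj : injective i.

Lemma sum_codom (P : pred 'I_n) (F : 'I_n -> R) :
  \sum_(x | P x && (x \in codom i)) F x = \sum_(r | P (i r)) F (i r).
Proof.
rewrite -(big_imset (A := [pred r | P (i r)]) F (in2W i_inj)) /=.
apply: eq_bigl => x; apply/andP/imsetP => [[Px /codomP[r e]]|[r Pr ->]].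
  by exists r; rewrite // inE -e.
by split=> //; exact: codom_f.
Qed.

(** Since [low_centered] has mean zero at each position, this is n! times a covariance. *)
Definition corner_corr (x : 'I_n) : R :=
  \sum_(sigma : 'S_n) (matches pi sigma i)%:R * low_centered (sigma x).

(** Rearranging the entries at [i] reaches every pattern but leaves the value at [x] alone. *)
Lemma corner_corr_off x : x \notin codom i -> corner_corr x = 0.
Proof.
move=> x_off; rewrite /corner_corr.
rewrite (@sum_matches_mul _ _ _ _ _ (fun sigma => low_centered (sigma x))) //.
  by rewrite mean_low_centered mul0r.
by move=> h sigma fix_h; rewrite permM fix_h.
Qed.

(** The total of [low_centered] over the positions [i] is minus the total over the remaining
    positions. It is therefore unchanged when the entries at [i] are rearranged, so it is
    uncorrelated with the pattern. *)
Lemma sum_corner_corr : \sum_r corner_corr (i r) = 0.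
Proof.
rewrite exchange_big /=.
have off (sigma : 'S_n) : \sum_r low_centered (sigma (i r)) =
    - \sum_(x | x \notin codom i) low_centered (sigma x).
  apply/eqP; rewrite -addr_eq0 -[X in _ == X](sum_low_centered_perm sigma).
  rewrite [X in _ == X](bigID (mem (codom i))) /=; apply/eqP; congr (_ + _).
  by rewrite [RHS](sum_codom predT).
under eq_bigr => sigma _ do rewrite -mulr_sumr.
rewrite (@sum_matches_mul _ _ _ _ _
  (fun sigma => \sum_r low_centered (sigma (i r)))) //.
  by rewrite exchange_big big1 ?mul0r // => r _; exact: mean_low_centered.
move=> h sigma fix_h; rewrite !off; congr (- _).
by apply: eq_bigr => x x_off; rewrite permM fix_h.
Qed.

Lemma corner_corrE x : corner_corr x =
  \sum_(sigma : 'S_n) (matches pi sigma i)%:R * (sigma x < D)%N%:R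
    - n`!%:R * (delta / k`!%:R).
Proof.
rewrite /corner_corr; under eq_bigr => sigma _ do rewrite mulrBr.
by rewrite sumrB -mulr_suml sum_matches_const // mulrAC mulrA.
Qed.

(** If the pattern is matched and the entry at [i r] is low, then the smaller entry at [i s] is low
    too. The joint event is thus contained in the event that both entries are low. *)
Lemma corner_corr_le r s : (pi s < pi r)%N ->
  corner_corr (i r) <= n`!%:R * (delta ^+ 2 - delta / k`!%:R).
Proof.
move=> lt_sr; rewrite corner_corrE mulrBr lerD2r.
have ne_sr : i s != i r.
  by apply: contraTneq lt_sr => /i_inj->; rewrite ltnn.
apply: le_trans (sum_low2 ne_sr); apply: ler_sum => sigma _.
case: (boolP (matches pi sigma i)) => [/matchesP m|_]; last first.
  by rewrite mul0r mulr_ge0.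
rewrite mul1r; case: (boolP (sigma (i r) < D)%N) => lt_rD;
  last by rewrite mulr0.
by rewrite (ltn_trans _ lt_rD) -?m // mulr1.
Qed.

Lemma norm_corner_corr_le x : `|corner_corr x| <= n`!%:R * delta.
Proof.
have k1 : 1 <= k`!%:R :> R by rewrite ler1n fact_gt0.
have d0 := delta_ge0.
have le_d : delta / k`!%:R <= delta.
  by rewrite ler_pdivrMr ?(lt_le_trans _ k1) // ler_peMr.
rewrite corner_corrE ler_norml; apply/andP; split.
  rewrite lerBrDr addrC -mulrBr (le_trans (y := 0)) //.
    by rewrite mulr_ge0_le0 // subr_le0.
  by apply: sumr_ge0 => sigma _; rewrite mulr_ge0.
rewrite lerBlDr -[leLHS]addr0 lerD //; last by rewrite mulr_ge0 // divr_ge0.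
rewrite -(sum_low x); apply: ler_sum => sigma _.
by case: (matches _ _ _); rewrite ?mul1r ?mul0r.
Qed.

Definition corner_cov : R :=
  \sum_(sigma : 'S_n) (matches pi sigma i)%:R * corner_stat sigma.

Lemma corner_covE : corner_cov = \sum_(r | (i r < M)%N) corner_corr (i r).
Proof.
rewrite /corner_cov; under eq_bigr => sigma _ do rewrite mulr_sumr.
rewrite exchange_big /= (bigID (mem (codom i))) /= [X in _ + X]big1 => [|x].
  by rewrite addr0 (sum_codom (fun x : 'I_n => x < M)%N).
by case/andP => _; exact: corner_corr_off.
Qed.

Lemma norm_corner_cov_le : `|corner_cov| <= k%:R * (n`!%:R * delta).
Proof.
rewrite corner_covE; apply: le_trans (ler_norm_sum _ _ _) _.
rewrite mulr_natl -[in X in _ *+ X](card_ord k) -sumr_const big_mkcond /=.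
apply: ler_sum => r _; case: ifP => _; first exact: norm_corner_corr_le.
by rewrite mulr_ge0 // delta_ge0.
Qed.

Lemma corner_cov0 : (forall r, M <= i r)%N -> corner_cov = 0.
Proof.
by move=> le_M; rewrite corner_covE big_pred0 // => r; rewrite ltnNge le_M.
Qed.

Hypothesis small_delta : delta * (2 * k`!%:R) <= 1.

(** [small_delta] makes [delta ^+ 2] at most half of [delta / k!], so the negative linear term
    wins. *)
Lemma corner_corr_neg r s : (pi s < pi r)%N ->
  corner_corr (i r) <= - (n`!%:R * (delta / (2 * k`!%:R))).
Proof.
move=> lt_sr; apply: le_trans (corner_corr_le lt_sr) _.
rewrite -[leRHS]mulrN ler_wpM2l //.
have k0 : 0 < k`!%:R :> R by rewrite ltr0n fact_gt0.
have -> : delta / k`!%:R = 2 * (delta / (2 * k`!%:R)).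
  by field; rewrite gt_eqF.
suff : delta ^+ 2 <= delta / (2 * k`!%:R) by lra.
by rewrite expr2 ler_wpM2l ?delta_ge0 // -[leRHS]mul1r ler_pdivlMr // mulr_gt0.
Qed.

(* The correlation with each entry of the pattern is negative, except possibly
   for its minimum, and these correlations sum to zero. *)
Lemma corner_cov_first_block (B : {set 'I_k}) (r0 r1 r2 : 'I_k) :
  (forall r, r != r0 -> pi r0 < pi r)%N -> r1 \in B -> r2 \notin B ->
  (forall r, (i r < M)%N = (r \in B)) ->
  n`!%:R * (delta / (2 * k`!%:R)) <=
    (if r0 \in B then corner_cov else - corner_cov).
Proof.
move=> min_r0 r1B r2B iB; set c := _ * (_ / _).
have c0 : 0 <= c by rewrite mulr_ge0 // divr_ge0 ?delta_ge0 // mulr_ge0.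
have neg r : r != r0 -> c <= - corner_corr (i r).
  by move=> /min_r0 /corner_corr_neg; rewrite lerNr.
have sum_neg (P : pred 'I_k) r : P r -> ~~ P r0 ->
    c <= - \sum_(s | P s) corner_corr (i s).
  move=> Pr NPr0; rewrite -sumrN (bigD1 r) //= -[leLHS]addr0.
  have ne s : P s -> s != r0 by apply: contraTneq => ->.
  by rewrite lerD ?neg ?ne // sumr_ge0 // => s /andP[/ne/neg/(le_trans c0)].
have covB : corner_cov = \sum_(r in B) corner_corr (i r).
  by rewrite corner_covE; apply: eq_bigl => r; rewrite iB.
case: ifP => r0B; last by rewrite covB (sum_neg _ r1) ?r0B.
(* If [r0] lies in [B], the zero total lets the complement of [B] replace [B]; it avoids [r0] and
   contains [r2]. *)
have := sum_corner_corr; rewrite (bigID (mem B)) /= -covB.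
move/eqP; rewrite addr_eq0 => /eqP->.
by rewrite (sum_neg _ r2) //= r0B.
Qed.

End PatternCorrelation.
End CornerStatistic.

(** * Admissible placements and the blocks of the pattern *)

(** The conditions of an occurrence that do not involve [sigma]; the number of occurrences becomes a
    sum over a fixed index set. *)
Definition admissible (k n : nat) (A : {set 'I_k.-1})
    (i : {ffun 'I_k -> 'I_n}) : bool :=
  [forall r : 'I_k, forall s : 'I_k, (r < s)%N ==> (i r < i s)%N] &&
  [forall a in A, forall r : 'I_k, forall s : 'I_k,
     ((r == a :> nat) && (s == a.+1 :> nat)) ==> (i s == (i r).+1 :> nat)].

Lemma num_occurrencesE (R : pzSemiRingType) (k n : nat) (pi : 'S_k)
    (A : {set 'I_k.-1}) (sigma : 'S_n) :
  (num_occurrences pi A sigma)%:R =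
    \sum_(i | admissible A i) (matches pi sigma i)%:R :> R.
Proof.
rewrite -natr_sum /num_occurrences -sum1_card; congr _%:R.
rewrite [RHS]big_mkcond [LHS]big_mkcond; apply: eq_bigr => i _.
rewrite inE /is_occurrence -/(matches pi sigma i) /admissible.
by case: (matches _ _ _); rewrite ?andbF //= ; case: ifP.
Qed.

Section Blocks.

Variables (k : nat) (A : {set 'I_k}).

Definition glued (a : nat) : bool := [exists a' in A, a' == a :> nat].

(** Walks left through glued gaps to the first index of the block of [r]; plain naturals make the
    recursion structural. *)
Fixpoint block_start (r : nat) : nat :=
  if r is r'.+1 then (if glued r' then block_start r' else r) else 0%N.

Lemma block_start_le r : (block_start r <= r)%N.
Proof. by elim: r => //= r IH; case: ifP => // _; exact: leqW. Qed.

Lemma block_start_lt (r : 'I_k.+1) : (block_start r < k.+1)%N.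
Proof. exact: leq_ltn_trans (block_start_le r) (ltn_ord r). Qed.

Lemma block_start_idem r : block_start (block_start r) = block_start r.
Proof. by elim: r => //= r IH; case: ifP => //= ->. Qed.

Lemma block_start_mono r s : (r <= s)%N -> (block_start r <= block_start s)%N.
Proof.
elim: s => [|s IH]; first by rewrite leqn0 => /eqP->.
rewrite leq_eqVlt => /predU1P[-> //|]; rewrite ltnS => le_rs /=.
case: ifP => _; first exact: IH.
exact: leq_trans (block_start_le r) (leqW le_rs).
Qed.

Definition starts : {set 'I_k.+1} := [set r : 'I_k.+1 | block_start r == r].

Lemma starts0 : ord0 \in starts. Proof. by rewrite inE. Qed.

Lemma startsN (r : 'I_k.+1) :
  r \notin starts -> exists2 a : 'I_k, a \in A & r = a.+1 :> nat.
Proof.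
rewrite inE; case: r => -[|r] //= lt_r; case: ifP; last by rewrite eqxx.
by move=> /exists_inP[a aA /eqP e] _; exists a; rewrite ?e.
Qed.

(** The indices that start no block are exactly the successors of elements of [A]. *)
Lemma card_starts : #|starts| = num_blocks (k := k.+1) A.
Proof.
suff eC : ~: starts = lift ord0 @: A.
  rewrite /num_blocks -(card_imset A (@lift_inj _ ord0)) -eC.
  by rewrite -[X in (X - _)%N](etrans (cardsC starts) (card_ord _)) addnK.
apply/setP => r; rewrite inE; apply/idP/imsetP => [/startsN[a aA e]|[a aA ->]].
  by exists a => //; apply: val_inj; rewrite /= e.
rewrite inE lift0 /= ifT; last by apply/exists_inP; exists a.
by rewrite ltn_eqF // ltnS block_start_le.
Qed.

(** * Counting admissible placements *)

Section Positions.

Variable n : nat.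
Implicit Types i : {ffun 'I_k.+1 -> 'I_n.+1}.

Lemma admissible_lt i (r s : 'I_k.+1) :
  admissible (k := k.+1) A i -> (r < s)%N -> (i r < i s)%N.
Proof. by case/andP => /forallP/(_ r)/forallP/(_ s)/implyP. Qed.

Lemma admissible_inj i : admissible (k := k.+1) A i -> injective i.
Proof.
move=> adm r s e; apply: val_inj; case: (ltngtP r s) => // /(admissible_lt adm).
  by rewrite e ltnn.
by rewrite e ltnn.
Qed.

Lemma admissible_glued i (a : 'I_k) (r s : 'I_k.+1) :
  admissible (k := k.+1) A i -> a \in A -> r = a :> nat -> s = a.+1 :> nat ->
  i s = (i r).+1 :> nat.
Proof.
case/andP => _ /forall_inP H aA er es; apply/eqP.
have /forallP/(_ r)/forallP/(_ s)/implyP := H a aA.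
by rewrite er es !eqxx; apply.
Qed.

(** Blocks are rigid: inside a block, positions differ exactly as indices do. The additive form
    avoids truncated subtraction. *)
Lemma admissible_block i (r s : 'I_k.+1) : admissible (k := k.+1) A i ->
  s = block_start r :> nat -> (i r + s = i s + r)%N.
Proof.
move=> adm; case: r => m; elim: m => [|m IH] lt_m /=.
  by move=> e; congr (i _ + _)%N; [apply: val_inj|].
case: ifP => [/exists_inP[a aA /eqP e] es|_ es]; last first.
  by congr (i _ + _)%N; [apply: val_inj|].
have /= IHm := IH (ltnW lt_m) es.
rewrite (admissible_glued (a := a) (r := Ordinal (ltnW lt_m)) adm aA) //=.
  by lia.
by rewrite e.
Qed.

(* An admissible placement is determined by its values on the block starts. *)
Lemma card_admissible_le (F : 'I_k.+1 -> {pred 'I_n.+1}) :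
  (#|[set i | admissible (k := k.+1) A i & [forall r in starts, i r \in F r]]|
    <= \prod_(r in starts) #|F r|)%N.
Proof.
(* The default [ord0] off the block starts is the one [pfamily] requires. *)
pose restr i : {ffun 'I_k.+1 -> 'I_n.+1} :=
  [ffun r => if r \in starts then i r else ord0].
set S := [set i | _ & _].
have restr_inj : {in S &, injective restr}.
  move=> i i'; rewrite !inE => /andP[adm _] /andP[adm' _] /ffunP e.
  apply/ffunP => r; apply: val_inj.
  have /(congr1 val) := e (Ordinal (block_start_lt r)).
  rewrite !ffunE inE /= block_start_idem eqxx.
  have /= := admissible_block (s := Ordinal (block_start_lt r)) adm erefl.
  have /= := admissible_block (s := Ordinal (block_start_lt r)) adm' erefl.
  lia.
rewrite -(card_in_imset restr_inj).
have <- : #|pfamily ord0 (mem starts) (fun r => F r)| =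
    (\prod_(r in starts) #|F r|)%N.
  by rewrite card_pfamily foldrE big_image.
apply: subset_leq_card; apply/subsetP => _ /imsetP[i iS ->].
move: iS; rewrite inE => /andP[_ /forall_inP iF].
apply/pfamilyP; split=> [|r rs]; last by rewrite ffunE rs iF.
apply/subsetP => r; rewrite !inE ffunE.
by case: ifP; rewrite ?inE ?eqxx // => ->.
Qed.

(** [block_start r == 0] singles out the first block, so precisely this block lies below [M]; the
    correlations of such placements all have the same sign. *)
Definition separated (M : nat) i : bool :=
  [forall r : 'I_k.+1, (i r < M)%N == (block_start r == 0%N)].

Lemma card_separated_ge (M W : nat) : (M <= W)%N ->
  (k.+1 * W + k.+1 <= n.+1)%N ->
  ((M - k.+1) * W ^ #|starts|.-1 <=
     #|[set i | admissible (k := k.+1) A i & separated M i]|)%N.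
Proof.
move=> le_MW le_Wn.
pose F (r : 'I_k.+1) : {pred 'I_n.+1} :=
  fun v => (v < if r == ord0 then M - k.+1 else W)%N.
have cardF (r : 'I_k.+1) : #|F r| = if r == ord0 then (M - k.+1)%N else W.
  rewrite -[RHS](@card_ord_lt n.+1); last by case: ifP; nia.
  by apply: eq_card => v; rewrite inE.
have -> : ((M - k.+1) * W ^ #|starts|.-1)%N =
    #|pfamily (ord0 : 'I_n.+1) (mem starts) F|.
  rewrite card_pfamily foldrE big_image /= (big_setD1 ord0) ?starts0 //=.
  rewrite cardF eqxx.
  rewrite (eq_bigr (fun=> W)) => [|r]; last first.
    by rewrite in_setD1 cardF => /andP[/negbTE->].
  by rewrite prod_nat_const [in LHS](cardsD1 ord0) starts0.
(* The block starting at [b] is shifted to [b * W + x b + b], with [x b < W], so blocks keep their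
   order. The first shift is below [M - k.+1], which keeps the first block below [M]; every other
   block begins beyond [W >= M]. *)
pose pos (x : {ffun 'I_k.+1 -> 'I_n.+1}) (r : 'I_k.+1) : nat :=
  (block_start r * W + x (inord (block_start r)) + r)%N.
have startP (r : 'I_k.+1) :
    (inord (block_start r) : 'I_k.+1) = block_start r :> nat.
  by rewrite inordK // block_start_lt.
have startS (r : 'I_k.+1) : inord (block_start r) \in starts.
  by rewrite inE startP block_start_idem.
pose place x : {ffun 'I_k.+1 -> 'I_n.+1} := [ffun r => inord (pos x r)].
have xF (x : {ffun 'I_k.+1 -> 'I_n.+1}) (r : 'I_k.+1) :
    x \in pfamily ord0 (mem starts) F ->
    (x (inord (block_start r))
       < if block_start r == 0%N then M - k.+1 else W)%N.
  move=> /pfamilyP[_ /(_ _ (startS r))]; rewrite unfold_in.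
  by rewrite -(inj_eq val_inj) /= startP.
have xW (x : {ffun 'I_k.+1 -> 'I_n.+1}) (r : 'I_k.+1) :
    x \in pfamily ord0 (mem starts) F -> (x (inord (block_start r)) < W)%N.
  by move=> /(xF x r); case: ifP => // _ /leq_trans; apply; lia.
have placeE (x : {ffun 'I_k.+1 -> 'I_n.+1}) (r : 'I_k.+1) :
    x \in pfamily ord0 (mem starts) F -> place x r = pos x r :> nat.
  move=> xP; rewrite ffunE inordK //.
  have := xW x r xP.
  have leW : (block_start r * W <= k * W)%N.
    by rewrite leq_mul2r -ltnS block_start_lt orbT.
  have := ltn_ord r; rewrite /pos; move: le_Wn; rewrite mulSn; lia.
have pos_mono (x : {ffun 'I_k.+1 -> 'I_n.+1}) (r s : 'I_k.+1) :
    x \in pfamily ord0 (mem starts) F -> (r < s)%N -> (pos x r < pos x s)%N.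
  move=> /(xW x r) lt_xW lt_rs; rewrite /pos.
  have := block_start_mono (ltnW lt_rs); rewrite leq_eqVlt => /predU1P[->|lt_b].
    by rewrite ltn_add2l.
  have : ((block_start r).+1 * W <= block_start s * W)%N.
    by rewrite leq_mul2r lt_b orbT.
  rewrite mulSn; lia.
have pos_lt (x : {ffun 'I_k.+1 -> 'I_n.+1}) (r : 'I_k.+1) :
    x \in pfamily ord0 (mem starts) F ->
    (pos x r < M)%N = (block_start r == 0%N).
  move=> /(xF x r); rewrite /pos.
  case: (posnP (block_start r)) => [->|b_gt0] /=.
    by have := ltn_ord r; rewrite mul0n add0n; lia.
  have : (1 * W <= block_start r * W)%N by rewrite leq_mul2r b_gt0 orbT.
  by lia.
have place_inj : {in pfamily ord0 (mem starts) F &, injective place}.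
  move=> x y xP yP e; apply/ffunP => r; apply: val_inj.
  case: (boolP (r \in starts)) => [rS|rN].
    have rE : inord (block_start r) = r.
      by apply: val_inj; rewrite /= startP; move: rS; rewrite inE => /eqP.
    by have := placeE x r xP; rewrite e placeE // /pos rE => /addIn/addnI.
  have off z : z \in pfamily ord0 (mem starts) F -> z r = ord0.
    move=> /pfamilyP[/subsetP/(_ r) H _]; apply: contraNeq rN => z0.
    by apply: H; rewrite inE.
  by rewrite !off.
rewrite -(card_in_imset place_inj); apply: subset_leq_card.
apply/subsetP => _ /imsetP[x xP ->]; rewrite inE; apply/andP; split.
  apply/andP; split.
    apply/forallP => r; apply/forallP => s; apply/implyP => lt_rs.
    by rewrite !placeE // pos_mono.
  apply/forall_inP => a aA; apply/forallP => r; apply/forallP => s.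
  apply/implyP => /andP[/eqP er /eqP es]; rewrite !placeE // /pos.
  have -> : block_start s = block_start r.
    by rewrite es er /= ifT //; apply/exists_inP; exists a.
  by rewrite es er addnS.
by apply/forallP => r; rewrite placeE // pos_lt.
Qed.

(** Either the first block straddles [M], which leaves at most [k.+1] choices for its start ([F1]),
    or a second block also starts below [M], which leaves at most [M ^ 2] choices for the two starts
    ([F2]). *)
Lemma card_not_separated_le (M : nat) : (M <= n.+1)%N ->
  (#|[set i | admissible (k := k.+1) A i & (i ord0 < M)%N && ~~ separated M i]|
   <= k.+1 * n.+1 ^ #|starts|.-1 + k.+1 * (M ^ 2 * n.+1 ^ #|starts|.-2))%N.
Proof.
move=> le_Mn.
pose F1 (r : 'I_k.+1) : {pred 'I_n.+1} :=
  fun v => (r == ord0) ==> (M - k.+1 <= v < M)%N.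
pose F2 (s r : 'I_k.+1) : {pred 'I_n.+1} :=
  fun v => (r \in [set ord0; s]) ==> (v < M)%N.
pose S (F : 'I_k.+1 -> {pred 'I_n.+1}) :=
  [set i | admissible (k := k.+1) A i & [forall r in starts, i r \in F r]].
have card_S1 : (#|S F1| <= k.+1 * n.+1 ^ #|starts|.-1)%N.
  apply: leq_trans (card_admissible_le F1) _.
  rewrite (big_setD1 ord0) ?starts0 //=; apply: leq_mul.
    have -> : #|F1 ord0| = #|[set v : 'I_n.+1 | (v < M)%N] :\:
                            [set v : 'I_n.+1 | (v < M - k.+1)%N]|.
      by apply: eq_card => v; rewrite !inE /= -leqNgt.
    rewrite cardsDS ?card_ord_lt //; [lia|lia|].
    by apply/subsetP => v; rewrite !inE; lia.
  rewrite (eq_bigr (fun=> n.+1)) => [|r]; last first.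
    rewrite in_setD1 => /andP[/negbTE r0 _].
    by rewrite -[RHS]card_ord; apply: eq_card => v; rewrite inE /F1 r0.
  by rewrite prod_nat_const [in leqRHS](cardsD1 ord0) starts0.
have card_S2 s : s \in starts -> s != ord0 ->
    (#|S (F2 s)| <= M ^ 2 * n.+1 ^ #|starts|.-2)%N.
  move=> sS s0; apply: leq_trans (card_admissible_le (F2 s)) _.
  have F2M r : r \in [set ord0; s] -> #|F2 s r| = M.
    move=> rS; rewrite -[RHS](@card_ord_lt n.+1) //.
    by apply: eq_card => v; rewrite !inE /F2 rS.
  have sS0 : s \in starts :\ ord0 by rewrite in_setD1 s0.
  rewrite (big_setD1 ord0) ?starts0 //= F2M ?set21 //.
  rewrite (big_setD1 s) //= F2M ?set22 // mulnA mulnn leq_mul //.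
  rewrite (eq_bigr (fun=> n.+1)) => [|r]; last first.
    rewrite !in_setD1 => /and3P[/negbTE rs /negbTE r0 _].
    by rewrite -[RHS]card_ord; apply: eq_card => v; rewrite inE /F2 !inE r0 rs.
  rewrite prod_nat_const [in leqRHS](cardsD1 ord0) starts0.
  by rewrite (cardsD1 s (starts :\ ord0)) sS0.
set B := (\bigcup_(s in starts :\ ord0) S (F2 s)).
have card_B : (#|B| <= k.+1 * (M ^ 2 * n.+1 ^ #|starts|.-2))%N.
  have : (#|B| <= \sum_(s in starts :\ ord0) #|S (F2 s)|)%N.
    rewrite /B; elim/big_rec2: _ => [|s m T _ IH]; first by rewrite cards0.
    by apply: leq_trans (leq_card_setU _ _) _; rewrite leq_add2l.
  move/leq_trans; apply.
  apply: (@leq_trans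
    (\sum_(s in starts :\ ord0) M ^ 2 * n.+1 ^ #|starts|.-2)%N).
    apply: leq_sum => s; rewrite !inE => /andP[s0 sS].
    by rewrite card_S2 // inE.
  by rewrite sum_nat_const leq_mul2r (leq_trans (max_card _)) ?card_ord ?orbT.
apply: leq_trans (leq_add card_S1 card_B).
apply: leq_trans (leq_card_setU _ _); apply: subset_leq_card.
apply/subsetP => i; rewrite !inE => /andP[adm /andP[i0M]].
rewrite negb_forall => /existsP[r sep_r].
have leq_i (a b : 'I_k.+1) : (a <= b)%N -> (i a <= i b)%N.
  rewrite leq_eqVlt => /predU1P[e|/(admissible_lt adm)/ltnW//].
  by rewrite (val_inj e).
have startS : Ordinal (block_start_lt r) \in starts.
  by rewrite inE /= block_start_idem.
have := admissible_block (s := Ordinal (block_start_lt r)) adm erefl.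
case: (eqVneq (block_start r) 0%N) sep_r => [e|ne] sep_r /= blk.
  apply/orP; left; rewrite adm; apply/forall_inP => s _.
  rewrite unfold_in; apply/implyP => /eqP->; rewrite i0M andbT.
  have eo : Ordinal (block_start_lt r) = ord0 by apply: val_inj.
  move: sep_r blk; rewrite eqb_id -leqNgt eo e addn0.
  have := ltn_ord r; lia.
apply/orP; right; apply/bigcupP; exists (Ordinal (block_start_lt r)).
  by rewrite in_setD1 startS andbT -(inj_eq val_inj).
rewrite inE adm; apply/forall_inP => s _; rewrite unfold_in; apply/implyP.
rewrite !inE => /orP[/eqP->//|/eqP->].
rewrite eqbF_neg negbK in sep_r; apply: leq_ltn_trans sep_r.
exact/leq_i/block_start_le.
Qed.
End Positions.
End Blocks.

(** * Assembling the case of two or more blocks *)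

(** Separated placements contribute with one common sign, placements starting at or after [M]
    contribute nothing, and the others are bounded in absolute value. *)
Lemma num_occurrences_corner_cov (R : realFieldType) (k n D M : nat)
    (pi : 'S_k.+1) (A : {set 'I_k}) :
  (D <= n.+1)%N -> (D * (2 * k.+1`!) <= n.+1)%N -> A != setT ->
  n.+1`!%:R * (D%:R / n.+1%:R) *
    (#|[set i : {ffun 'I_k.+1 -> 'I_n.+1} |
           admissible (k := k.+1) A i & separated A M i]|%:R
         / (2 * k.+1`!%:R)
      - k.+1%:R * #|[set i : {ffun 'I_k.+1 -> 'I_n.+1} |
           admissible (k := k.+1) A i &
           (i ord0 < M)%N && ~~ separated A M i]|%:R)
  <= `|\sum_(sigma : 'S_n.+1) (num_occurrences (k := k.+1) pi A sigma)%:R *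
         corner_stat R D M sigma| :> R.
Proof.
move=> le_Dn le_Dkn A_neqT; set c := _`!%:R * _.
have c0 : 0 <= c by rewrite mulr_ge0 // divr_ge0.
have small : D%:R / n.+1%:R * (2 * k.+1`!%:R) <= 1 :> R.
  by rewrite mulrAC ler_pdivrMr ?ltr0n // mul1r -!natrM ler_nat.
set r0 := (pi^-1 ord0)%g.
have min_r0 r : r != r0 -> (pi r0 < pi r)%N.
  rewrite permKV /= lt0n; apply: contra => /eqP e; apply/eqP.
  by rewrite /r0 -[r](permK pi); congr (_ _); apply: val_inj.
pose B := [set r : 'I_k.+1 | block_start A r == 0%N].
(* A gap outside [A] ends a block, so the index after it is not in the first block. *)
have [r2 r2B] : exists r2, r2 \notin B.
  have : ~: A != set0 by rewrite -setCT (inj_eq (@setC_inj _)).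
  case/set0Pn => a; rewrite inE => aA; exists (lift ord0 a).
  rewrite inE lift0 /=; case: ifP => // /exists_inP[b bA /eqP e].
  by rewrite -(val_inj e) bA in aA.
have r1B : ord0 \in B by rewrite inE.
(* The common sign depends only on whether the minimum of [pi] lies in the first block. *)
pose eta : R := if r0 \in B then 1 else -1.
have -> : \sum_(sigma : 'S_n.+1)
      (num_occurrences (k := k.+1) pi A sigma)%:R * corner_stat R D M sigma =
    \sum_(i : {ffun 'I_k.+1 -> 'I_n.+1} | admissible (k := k.+1) A i)
      corner_cov R D M pi i.
  rewrite exchange_big /=; apply: eq_bigr => sigma _.
  by rewrite (@num_occurrencesE R k.+1) mulr_suml.
apply: (@le_trans _ _ (eta *
  \sum_(i : {ffun 'I_k.+1 -> 'I_n.+1} | admissible (k := k.+1) A i)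
     corner_cov R D M pi i)); last first.
  apply: le_trans (ler_norm _) _; rewrite normrM /eta.
  by case: ifP => _; rewrite ?normrN normr1 mul1r.
rewrite mulr_sumr.
have card_sum (P : pred {ffun 'I_k.+1 -> 'I_n.+1}) :
    #|[set i | admissible (k := k.+1) A i & P i]|%:R =
    \sum_(i | admissible (k := k.+1) A i) (P i)%:R :> R.
  rewrite -natr_sum -sum1_card; congr _%:R.
  rewrite [RHS]big_mkcond [LHS]big_mkcond; apply: eq_bigr => i _; rewrite inE.
  by case: (P i); rewrite ?andbF ?andbT //; case: ifP.
rewrite !card_sum mulr_suml mulr_sumr -sumrB mulr_sumr.
apply: ler_sum => i adm; have i_inj := admissible_inj adm.
have bound : - (k.+1%:R * c) <= eta * corner_cov R D M pi i.
  have := norm_corner_cov_le R M (ltn0Sn n) le_Dn pi i_inj; rewrite ler_norml.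
  rewrite -/c /eta; case: ifP => _ /andP[h1 h2]; first by rewrite mul1r.
  by rewrite mulN1r lerN2.
case: (boolP (separated A M i)) => [/forallP sep|_]; last first.
  rewrite andbT mul0r sub0r; case: (ltnP (i ord0) M) => [_|le_M].
    by rewrite mulr1 mulrN mulrC.
  rewrite mulr0 oppr0 mulr0 corner_cov0 ?mulr0 // => r; apply: leq_trans le_M _.
  have [e|r_gt0] := posnP r; last exact/ltnW/(admissible_lt adm).
  by rewrite (_ : r = ord0) //; apply: val_inj.
rewrite andbF mulr0 subr0 mul1r.
have iB r : (i r < M)%N = (r \in B) by rewrite inE; have /eqP := sep r.
have := @corner_cov_first_block R n.+1 D M (ltn0Sn n) le_Dn _ pi i i_inj small
  B r0 ord0 r2 min_r0 r1B r2B iB.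
by rewrite mulrA /eta; case: ifP; rewrite ?mul1r ?mulN1r.
Qed.

(* G bounds the main term from below and L the error terms from above; q is
   chosen so that each of the two parts of L costs at most a quarter of the main
   term. *)
Lemma main_term_dominates (R : realFieldType) (k n j M W q K G L : nat) :
  (0 < k)%N ->
  K = ((2 * k) ^ j.+1 * (4 * k`!))%N -> q = (4 * k ^ 2 * K)%N ->
  (q ^ 2 <= n)%N ->
  (n <= 2 * q * (M - k))%N -> (M * q <= n)%N -> (n <= 2 * k * W)%N ->
  ((M - k) * W ^ j.+1 <= G)%N ->
  (L <= k * n ^ j.+1 + k * (M ^ 2 * n ^ j))%N ->
  n%:R ^+ j.+2 / (2 * q%:R * K%:R) <= G%:R / (2 * k`!%:R) - k%:R * L%:R :> R.
Proof.
move=> k_gt0 eK eq le_qn le_nM le_Mq le_nW le_G le_L.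
have f0 : (0 < k`!)%N by rewrite fact_gt0.
have K0 : (0 < K)%N by rewrite eK muln_gt0 expn_gt0 !muln_gt0 k_gt0 f0.
have q0 : (0 < q)%N by rewrite eq !muln_gt0 K0 k_gt0.
(* The main term is at least twice the claimed bound. *)
have hG : (2 * k`! * n ^ j.+2 <= q * K * G)%N.
  apply: (@leq_trans (q * K * ((M - k) * W ^ j.+1))%N);
    last by rewrite leq_mul2l le_G orbT.
  have h : (n ^ j.+2 <= 2 * q * (M - k) * (2 * k * W) ^ j.+1)%N.
    by rewrite expnS leq_mul // leq_exp2r.
  have -> : (q * K * ((M - k) * W ^ j.+1) =
            2 * k`! * (2 * q * (M - k) * (2 * k * W) ^ j.+1))%N.
    rewrite [in LHS]eK [in RHS]expnMn.
    move: (_ ^ j.+1)%N (W ^ j.+1)%N k`! => u v f.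
    by ring.
  by rewrite leq_mul2l h orbT.
have eqq : (q ^ 2 = 4 * k ^ 2 * K * q)%N by rewrite -mulnn {1}eq.
(* The error is at most the claimed bound: its first part by [q ^ 2 <= n], its second by
   [M * q <= n]. *)
have hL : (2 * q * K * (k * L) <= n ^ j.+2)%N.
  have h1 : (4 * q * K * (k ^ 2 * n ^ j.+1) <= n ^ j.+2)%N.
    have -> : (4 * q * K * (k ^ 2 * n ^ j.+1) = q ^ 2 * n ^ j.+1)%N.
      by rewrite eqq; move: (n ^ _)%N => u; ring.
    by rewrite [leqRHS]expnS leq_mul2r le_qn orbT.
  have h2 : (4 * q * K * (k ^ 2 * (M ^ 2 * n ^ j)) <= n ^ j.+2)%N.
    have -> : (4 * q * K * (k ^ 2 * (M ^ 2 * n ^ j)) = (M * q) ^ 2 * n ^ j)%N.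
      by rewrite expnMn eqq; move: (n ^ _)%N => u; ring.
    by rewrite -[j.+2]addn2 addnC expnD leq_mul // leq_exp2r.
  have h3 : (4 * q * K * (k * L) <=
      4 * q * K * (k * (k * n ^ j.+1 + k * (M ^ 2 * n ^ j))))%N.
    by rewrite !leq_mul.
  have h4 : (4 * q * K * (k * (k * n ^ j.+1 + k * (M ^ 2 * n ^ j))) =
     4 * q * K * (k ^ 2 * n ^ j.+1) +
     4 * q * K * (k ^ 2 * (M ^ 2 * n ^ j)))%N.
    by move: (n ^ _)%N (n ^ _)%N => u v; ring.
  have h5 : (4 * q * K * (k * L) = 2 * (2 * q * K * (k * L)))%N by ring.
  lia.
have fR : 0 < k`!%:R :> R by rewrite ltr0n.
have KR : 0 < K%:R :> R by rewrite ltr0n.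
have qR : 0 < q%:R :> R by rewrite ltr0n.
rewrite -natrX; move: (n ^ j.+2)%N hG hL => N.
rewrite -!(ler_nat R) !natrM => hG hL.
rewrite lerBrDr -(@ler_pM2l _ (2 * q%:R * K%:R)) ?mulr_gt0 // mulrDr mulrCA.
rewrite divff ?mulr1; last first.
  by rewrite gt_eqF ?mulr_gt0.
have : 2 * N%:R <= 2 * q%:R * K%:R * (G%:R / (2 * k`!%:R)) :> R.
  rewrite mulrA ler_pdivlMr ?mulr_gt0 //.
  apply: le_trans (_ : _ <= 2 * (q%:R * K%:R * G%:R)) _; first lra.
  by rewrite !mulrA.
lra.
Qed.

(** The quotient is at least [2 * c.+1], so rounding down and subtracting [c] together lose at most
    half of N / q. *)
Lemma leq_mul_divn_sub (N q c : nat) :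
  (0 < q)%N -> (2 * c.+1 * q <= N)%N -> (N <= 2 * q * (N %/ q - c))%N.
Proof.
move=> q0 le_qN; apply: (leq_trans (ltnW (ltn_ceil N q0))).
rewrite mulnAC leq_mul2r; apply/orP; right.
by rewrite -leq_divRL // in le_qN; move: (N %/ q)%N le_qN => M; lia.
Qed.

Lemma variance_many_blocks (R : realType) (k : nat) (pi : 'S_k.+1)
    (A : {set 'I_k}) : A != setT ->
  exists2 C : R, 0 < C & exists n0 : nat, forall n : nat, (n0 <= n)%N ->
    C * n%:R ^+ (2 * num_blocks (k := k.+1) A - 1) <=
      unif_variance
        (fun sigma : 'S_n => (num_occurrences (k := k.+1) pi A sigma)%:R : R).
Proof.
move=> A_neqT; have [d ed] : exists d, d = (2 * k.+1`!)%N by eexists.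
have lt_Ak : (#|A| < k)%N.
  rewrite -[X in (_ < X)%N](card_ord k) -cardsT; apply: proper_card.
  by rewrite properT.
have [j ej] : exists j, num_blocks (k := k.+1) A = j.+2.
  by exists (k - #|A|).-1; rewrite /num_blocks subSn ?prednK ?subn_gt0 // ltnW.
have [K eK] : exists K, K = ((2 * k.+1) ^ j.+1 * (4 * k.+1`!))%N by eexists.
have [q eq] : exists q, q = (4 * k.+1 ^ 2 * K)%N by eexists.
have f0 : (0 < k.+1`!)%N by rewrite fact_gt0.
have p0 : (0 < (2 * k.+1) ^ j.+1)%N by rewrite expn_gt0.
have K0 : (0 < K)%N by rewrite eK muln_gt0 p0 muln_gt0 f0.
have d0 : (0 < d)%N by rewrite ed muln_gt0 f0.
have le_dq : (2 * d <= q)%N.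
  have -> : q = (2 * d * (4 * k.+1 ^ 2 * (2 * k.+1) ^ j.+1))%N.
    by rewrite eq eK ed; move: (_ ^ j.+1)%N k.+1`! => u v; ring.
  by rewrite leq_pmulr // !muln_gt0 p0.
have le_kq : (4 * k.+1 <= q)%N.
  have -> : q = (4 * k.+1 * (k.+1 * K))%N by rewrite eq -mulnn; ring.
  by rewrite leq_pmulr // muln_gt0.
have q0 : (0 < q)%N by exact: leq_trans le_kq.
(* The covariance is at least [N ^ j.+2 / (4 * d * q * K)]: the factor [D / N] is at least
   [1 / (2 * d)], and the difference of main and error terms is at least
   [N ^ j.+2 / (2 * q * K)]. *)
exists ((4 * d * q * K)%:R ^- 2).
  by rewrite invr_gt0 exprn_gt0 // ltr0n !muln_gt0 d0 q0 K0.
exists (q ^ 2)%N => -[|n] le_qn.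
  by rewrite leqn0 expn_eq0 -leqn0 leqNgt q0 in le_qn.
set N := n.+1 in le_qn *.
have N0 : 0 < N%:R :> R by rewrite ltr0n.
have le_qN : (q <= N)%N by apply: leq_trans le_qn; rewrite -mulnn leq_pmulr.
(* [D] meets [small_delta], [M] is small enough to control nonseparated placements, and [k.+1]
   stretches of length [W] fit with [k.+1] positions to spare. *)
pose D := (N %/ d)%N; pose M := (N %/ q)%N; pose W := (N %/ k.+1 - 1)%N.
have le_D : (D * d <= N)%N by exact: leq_divM.
have ge_D : (N <= 2 * d * D)%N.
  by rewrite -[D]subn0 leq_mul_divn_sub // muln1; exact: leq_trans le_qN.
have le_M : (M * q <= N)%N by exact: leq_divM.
have ge_M : (N <= 2 * q * (M - k.+1))%N.
  apply: leq_mul_divn_sub => //; apply: leq_trans le_qn.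
  by rewrite -mulnn leq_mul2r; apply/orP; right; clear -le_kq; lia.
have le_W : (k.+1 * W + k.+1 <= N)%N.
  have := leq_divM N k.+1; rewrite /W mulnBr muln1 mulnC => le_N.
  rewrite subnK // leq_pmulr // divn_gt0 //; clear -le_kq le_qN; lia.
have ge_W : (N <= 2 * k.+1 * W)%N.
  by apply: leq_mul_divn_sub => //; clear -le_kq le_qN; lia.
have le_MW : (M <= W)%N.
  rewrite -(@leq_pmul2l (2 * k.+1)) //; apply: leq_trans ge_W.
  apply: leq_trans le_M; rewrite mulnC leq_mul2l; apply/orP; right.
  by clear -le_kq; lia.
have le_DN : (D <= N)%N by exact: leq_div.
have le_MN : (M <= N)%N by exact: leq_div.
have ge_G := card_separated_ge A le_MW (n := n).
have le_L := card_not_separated_le A le_MN.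
rewrite card_starts ej /= -/N in ge_G le_L.
have {}ge_G := ge_G le_W.
have dom := @main_term_dominates R k.+1 N j M W q K _ _ isT eK eq le_qn
  ge_M le_M ge_W ge_G le_L.
have {}le_D : (D * (2 * k.+1`!) <= N)%N by rewrite -ed.
have cov := @num_occurrences_corner_cov R k n D M pi A le_DN le_D A_neqT.
pose w : R := N%:R ^+ j.+2 / (4 * d * q * K)%:R.
have w0 : 0 <= w by rewrite divr_ge0 // exprn_ge0.
have -> : (4 * d * q * K)%:R ^- 2 * N%:R ^+ (2 * num_blocks (k := k.+1) A - 1) =
    w ^+ 2 / N%:R :> R.
  have -> : (2 * num_blocks (k := k.+1) A - 1 = (j.+1 + j.+2))%N.
    by rewrite ej; clear; lia.
  have Z0 : (4 * d * q * K)%:R != 0 :> R.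
    by rewrite pnatr_eq0 -lt0n !muln_gt0 d0 q0 K0.
  rewrite /w exprD (exprS _ j.+1).
  move: (_ ^+ j.+1) (_%:R) Z0 => y Z Z0; field.
  by rewrite Z0 gt_eqF.
apply: (unif_variance_ge (Y := corner_stat R D M)) => //.
- by rewrite card_Sn fact_gt0.
- exact: sum_corner_stat.
- by rewrite card_Sn; exact: sum_sqr_corner_stat.
rewrite card_Sn; apply: le_trans cov; rewrite -mulrA ler_wpM2l //.
apply: le_trans (ler_wpM2l _ dom); last by rewrite divr_ge0.
rewrite /w !natrM.
have : (2 * d%:R)^-1 <= D%:R / N%:R :> R.
  rewrite ler_pdivlMr // mulrC ler_pdivrMr ?mulr_gt0 ?ltr0n //.
  by rewrite -!natrM ler_nat mulnC.
set u := N%:R ^+ _ / (2 * _ * _).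
have -> : N%:R ^+ j.+2 / (4 * d%:R * q%:R * K%:R) = (2 * d%:R)^-1 * u :> R.
  by rewrite /u; field; rewrite !pnatr_eq0 -!lt0n d0 q0 K0.
apply: ler_wpM2r; rewrite divr_ge0 ?exprn_ge0 // !mulr_ge0 //.
Qed.

(** * One block *)

Section WindowSwap.

Variables (R : realFieldType) (k n : nat).
Let L := (3 * k)%N.
Let N := (n %/ L)%N.

Lemma window_subproof (m : 'I_N) (x : 'I_L) : (m * L + x < n)%N.
Proof.
apply: (@leq_trans (m.+1 * L)); first by rewrite mulSn addnC ltn_add2r.
by apply: leq_trans (leq_divM n L); rewrite leq_mul2r ltn_ord orbT.
Qed.

Definition window (m : 'I_N) (x : 'I_L) : 'I_n := Ordinal (window_subproof m x).

Lemma middle_subproof (r : 'I_k) : (k + r < L)%N.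
Proof. by have := ltn_ord r; rewrite /L; lia. Qed.

(** The margins of length [k] on both sides ensure that [k] consecutive positions meeting the middle
    stay inside the window. *)
Definition middle (m : 'I_N) (r : 'I_k) : 'I_n :=
  window m (Ordinal (middle_subproof r)).

Lemma window_inj m : injective (window m).
Proof. by move=> x y /(congr1 val) /= /addnI e; apply: val_inj. Qed.

Lemma middle_inj m : injective (middle m).
Proof.
by move=> r s /window_inj /(congr1 val) /= /addnI e; apply: val_inj.
Qed.

Lemma window_disjoint m m' x y : window m x = window m' y -> m = m'.
Proof.
move=> /(congr1 val) /= e; apply: val_inj => /=.
have L0 : (0 < L)%N by apply: leq_ltn_trans (ltn_ord x).
have div (p : 'I_N) (z : 'I_L) : ((p * L + z) %/ L = p)%N.
  by rewrite divnMDl // divn_small ?addn0.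
by rewrite -(div m x) e div.
Qed.

Variables (kappa : 'S_k) (g : 'I_N -> 'S_n).
Hypothesis gE : forall m r, g m (middle m (kappa r)) = middle m r.
Hypothesis g_fix : forall m x, x \notin codom (middle m) -> g m x = x.

Lemma g_window m x : exists y, g m (window m x) = window m y.
Proof.
case: (boolP (window m x \in codom (middle m))) => [/codomP[r ->]|/g_fix->].
  by rewrite -(permKV kappa r) gE; eexists.
by exists x.
Qed.

Lemma g_window_neq m m' x : m' != m -> g m (window m' x) = window m' x.
Proof.
move=> ne; apply: g_fix; apply: contra ne => /codomP[r].
by rewrite /middle => /window_disjoint ->.
Qed.

Definition increasing_on (m : 'I_N) (sigma : 'S_n) : bool :=
  matches 1 sigma (window m).

(** [g m] undoes the rearrangement by [kappa]: the second indicator detects an increasing window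
    whose middle was rearranged into the pattern [kappa]. *)
Definition window_diff (m : 'I_N) (sigma : 'S_n) : R :=
  (increasing_on m sigma)%:R - (increasing_on m (g m * sigma)%g)%:R.

Definition window_stat (sigma : 'S_n) : R := \sum_m window_diff m sigma.

Lemma sum_window_diff m : \sum_sigma window_diff m sigma = 0.
Proof.
by rewrite sumrB [X in X - _](reindex_inj (mulgI (g m))) /= subrr.
Qed.

Lemma eq_increasing_on m (s t : 'S_n) :
  (forall x, s (window m x) = t (window m x)) ->
  increasing_on m s = increasing_on m t.
Proof.
move=> e; apply: eq_forallb => x; apply: eq_forallb => y.
by rewrite !e.
Qed.

Lemma window_diff_mul m m' sigma : m' != m ->
  window_diff m' (g m * sigma)%g = window_diff m' sigma.
Proof.
move=> ne; rewrite /window_diff; congr (_%:R - _%:R).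
  congr nat_of_bool; apply: eq_increasing_on => x.
  by rewrite permM g_window_neq.
congr nat_of_bool; apply: eq_increasing_on => x.
by have [y e] := g_window m' x; rewrite !permM e g_window_neq.
Qed.

(** Replacing [sigma] by [g m * sigma] fixes the factor of window [m'], so the two halves of
    [window_diff m] give equal sums and cancel. *)
Lemma window_diff_orthogonal m m' : m' != m ->
  \sum_sigma window_diff m sigma * window_diff m' sigma = 0.
Proof.
move=> ne; under eq_bigr => sigma _ do rewrite mulrBl.
rewrite sumrB [X in X - _](reindex_inj (mulgI (g m))) /=.
apply/eqP; rewrite subr_eq0; apply/eqP; apply: eq_bigr => sigma _.
by rewrite window_diff_mul.
Qed.

Lemma sum_window_stat : \sum_sigma window_stat sigma = 0.
Proof. by rewrite exchange_big big1 // => m _; exact: sum_window_diff. Qed.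

Lemma sum_sqr_window_stat :
  \sum_sigma window_stat sigma ^+ 2 <= n`!%:R * N%:R.
Proof.
have -> : \sum_sigma window_stat sigma ^+ 2 =
    \sum_m \sum_m' \sum_sigma window_diff m sigma * window_diff m' sigma.
  under [RHS]eq_bigr => m _ do rewrite exchange_big.
  rewrite exchange_big /=; apply: eq_bigr => sigma _.
  by rewrite expr2 mulr_suml; apply: eq_bigr => m _; rewrite mulr_sumr.
rewrite mulr_natr -[in leRHS](card_ord N) -sumr_const; apply: ler_sum => m _.
rewrite (bigD1 m) //= [X in _ + X]big1 => [|m'];
  last exact: window_diff_orthogonal.
rewrite addr0 -card_Sn -sumr_const; apply: ler_sum => sigma _.
rewrite /window_diff; case: (increasing_on _ _);
  case: (increasing_on _ _) => /=;
  by rewrite ?subr0 ?sub0r ?subrr ?mulr0 ?mulr1 ?mulrNN ?mulr1 ?ler01.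
Qed.

(** A substitution moves the difference onto [f]: it remains to compare [f] before and after
    rearranging an increasing window. *)
Lemma sum_mul_window_diff (f : 'S_n -> R) m :
  \sum_sigma f sigma * window_diff m sigma =
  \sum_sigma (increasing_on m sigma)%:R * (f sigma - f ((g m)^-1 * sigma)%g).
Proof.
under eq_bigr => sigma _ do rewrite mulrBr.
rewrite sumrB [X in _ - X](reindex_inj (mulgI (g m)^-1%g)) /= -sumrB.
by apply: eq_bigr => sigma _; rewrite mulgA mulgV mul1g mulrBr !(mulrC (f _)).
Qed.

End WindowSwap.

(** * Assembling the case of one block *)

Lemma block_start_setT (k r : nat) :
  (r <= k)%N -> block_start [set: 'I_k] r = 0%N.
Proof.
elim: r => //= r IH lt_rk; rewrite ifT ?IH ?(ltnW lt_rk) //.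
by apply/exists_inP; exists (Ordinal lt_rk).
Qed.

Lemma variance_one_block (R : realType) (k : nat) (pi : 'S_k.+2) :
  exists2 C : R, 0 < C & exists n0 : nat, forall n : nat, (n0 <= n)%N ->
    C * n%:R ^+ (2 * num_blocks (k := k.+2) [set: 'I_k.+1] - 1) <=
      unif_variance (fun sigma : 'S_n =>
        (num_occurrences (k := k.+2) pi [set: 'I_k.+1] sigma)%:R : R).
Proof.
have -> : (2 * num_blocks (k := k.+2) [set: 'I_k.+1] - 1 = 1)%N.
  by rewrite /num_blocks cardsT card_ord subSnn.
have [L eL] : exists L, L = (3 * k.+2)%N by eexists.
have L0 : (0 < L)%N by rewrite eL.
have f0 : 0 < (L`!)%:R :> R by rewrite ltr0n fact_gt0.
(* With [N] windows the covariance is at least [N / L!] and the second moment at most [N]; moreover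
   [N >= n / (2 * L)]. *)
exists ((2 * L%:R)^-1 / L`!%:R ^+ 2).
  by rewrite divr_gt0 ?invr_gt0 ?exprn_gt0 // mulr_gt0 // ltr0n.
exists (2 * L)%N => -[|n] le_Ln; first by rewrite leqNgt muln_gt0 L0 in le_Ln.
have ge_N : (n.+1 <= 2 * L * (n.+1 %/ L))%N.
  by rewrite -[(_ %/ _)%N]subn0 leq_mul_divn_sub // muln1.
have N0 : (0 < n.+1 %/ L)%N.
  by rewrite divn_gt0 // (leq_trans _ le_Ln) // leq_pmull.
move: eL ge_N N0 f0 => -> ge_N N0 f0; set N := (n.+1 %/ _)%N in ge_N N0 *.
(* For the identity pattern the middle must be put into another order; a transposition does so,
   since the pattern has at least two entries. *)
pose kappa : 'S_k.+2 := if pi == 1%g then tperm ord0 ord_max else pi.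
have /fin_all_exists[g gP] (m : 'I_N) : exists h : 'S_n.+1,
    (forall r, h (middle m r) = middle m (kappa^-1 r)%g) /\
    (forall x, x \notin codom (middle m) -> h x = x).
  exact: extend_perm (@middle_inj _ _ m).
have gE m r : g m (middle m (kappa r)) = middle m r.
  by rewrite (gP m).1 permK.
have g_fix m x : x \notin codom (middle m) -> g m x = x by exact: (gP m).2.
pose eta : R := if pi == 1%g then 1 else -1.
pose X (sigma : 'S_n.+1) : R :=
  (num_occurrences (k := k.+2) pi [set: 'I_k.+1] sigma)%:R.
(* The placement on the middle contributes exactly 1. Any other placement meeting the middle lies in
   the window, where [sigma] shows only the identity pattern, so its term is nonnegative. Placements
   missing the middle do not change. *)
have key m sigma : increasing_on m sigma ->
    1 <= eta * (X sigma - X ((g m)^-1 * sigma)%g).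
  move=> inc; set tau := ((g m)^-1 * sigma)%g.
  have eq_kappa : (pi == kappa) = (pi != 1%g).
    rewrite /kappa; case: (eqVneq pi 1%g) => [->|]; rewrite ?eqxx //.
    by apply/negP => /eqP/permP/(_ ord0); rewrite tpermL perm1.
  have tau_middle r : tau (middle m r) = sigma (middle m (kappa r)).
    by rewrite permM -gE permK.
  have inc_lt (x y : 'I_(3 * k.+2)) :
      (sigma (window m x) < sigma (window m y))%N = (x < y)%N.
    by have /matchesP/(_ x y) := inc; rewrite !perm1.
  have Xmid : matches kappa tau (middle m).
    by apply/matchesP => r s; rewrite !tau_middle inc_lt /= ltn_add2l.
  have X1 i : injective i -> matches 1 sigma i ->
      matches pi sigma i = (pi == 1%g).
    move=> i_inj m1; apply/idP/eqP => [mp|->//]; exact: matches_uniq mp m1.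
  pose term (i : {ffun 'I_k.+2 -> 'I_n.+1}) : R :=
    eta * ((matches pi sigma i)%:R - (matches pi tau i)%:R).
  have -> : eta * (X sigma - X tau) =
      \sum_(i | admissible (k := k.+2) [set: 'I_k.+1] i) term i.
    by rewrite /X !(@num_occurrencesE R k.+2) -sumrB mulr_sumr.
  have adm_mid : admissible (k := k.+2) [set: 'I_k.+1] [ffun r => middle m r].
    apply/andP; split.
      apply/forallP => r; apply/forallP => s; apply/implyP => lt_rs.
      by rewrite !ffunE /= !ltn_add2l.
    apply/forall_inP => a _; apply/forallP => r; apply/forallP => s.
    by apply/implyP => /andP[/eqP er /eqP es]; rewrite !ffunE /= er es !addnS.
  rewrite (bigD1 _ adm_mid) /= -[leLHS]addr0; apply: lerD.
    have -> : term [ffun r => middle m r] =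
        eta * ((pi == 1%g)%:R - (pi == kappa)%:R).
      congr (_ * (_%:R - _%:R)); congr nat_of_bool.
        apply: X1 => [r t|]; first by rewrite !ffunE => /middle_inj.
        by apply/matchesP => r t; rewrite !ffunE inc_lt !perm1 /= ltn_add2l.
      have mk : matches kappa tau [ffun r => middle m r].
        by apply/matchesP => r t; rewrite !ffunE; have /matchesP-> := Xmid.
      apply/idP/eqP => [mp|-> //]; exact: matches_uniq mp mk.
    rewrite eq_kappa /eta; case: (pi == 1%g); first by rewrite subr0 mulr1.
    by rewrite sub0r mulrNN mulr1.
  apply: sumr_ge0 => i /andP[adm _].
  have i_shift r : (i r = i ord0 + r :> nat)%N.
    have := admissible_block (r := r) (s := ord0) adm.
    by rewrite block_start_setT ?addn0; [apply|rewrite -ltnS].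
  case: (boolP [exists r, i r \in codom (middle m)]) => [|/existsPn off].
    case/existsP => r /codomP[t /(congr1 val)/= e].
    have ge0 : (m * (3 * k.+2) <= i ord0)%N.
      by have := i_shift r; have := ltn_ord r; rewrite e; lia.
    have lt3 (u : 'I_k.+2) : (i ord0 - m * (3 * k.+2) + u < 3 * k.+2)%N.
      have := ltn_ord r; have := ltn_ord t; have := ltn_ord u.
      by have := i_shift r; rewrite e; lia.
    have iE u : i u = window m (Ordinal (lt3 u)).
      by apply: val_inj; rewrite /= i_shift addnA subnKC.
    rewrite /term X1; last 2 first.
    - exact: admissible_inj adm.
    - apply/matchesP => u v.
      by rewrite (iE u) (iE v) inc_lt !perm1 /= ltn_add2l.
    rewrite /eta; case: (pi == 1%g); case: (matches _ _ _) => /=; lra.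
  rewrite /term.
  have -> : matches pi tau i = matches pi sigma i.
    apply: eq_forallb => r; apply: eq_forallb => s; rewrite /tau !permM.
    by rewrite -[in LHS](g_fix m _ (off r)) -[in LHS](g_fix m _ (off s)) !permK.
  by rewrite subrr mulr0.
have NR : 0 < N%:R :> R by rewrite ltr0n.
move: f0; set F := (_`!)%:R => f0.
pose w : R := N%:R / F.
apply: (@le_trans _ _ (w ^+ 2 / N%:R)).
  have -> : w ^+ 2 / N%:R = N%:R / F ^+ 2.
    by rewrite /w; field; rewrite !gt_eqF.
  rewrite mulrAC ler_wpM2r ?invr_ge0 ?exprn_ge0 ?(ltW f0) //.
  by rewrite mulrC ler_pdivrMr ?mulr_gt0 ?ltr0n // expr1 -!natrM ler_nat mulnC.
apply: (unif_variance_ge (Y := window_stat R g)) => //.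
- by rewrite card_Sn fact_gt0.
- by rewrite divr_ge0 // ltW.
- exact: sum_window_stat.
- by rewrite card_Sn; exact: sum_sqr_window_stat gE g_fix.
apply: (@le_trans _ _ (eta * \sum_sigma X sigma * window_stat R g sigma));
  last first.
  apply: le_trans (ler_norm _) _; rewrite normrM /eta.
  by case: ifP => _; rewrite ?normrN normr1 mul1r.
under eq_bigr => sigma _ do rewrite mulr_sumr.
rewrite exchange_big /= mulr_sumr card_Sn.
have -> : n.+1`!%:R * w = \sum_(m : 'I_N) n.+1`!%:R / F.
  by rewrite sumr_const card_ord -[RHS]mulr_natr /w mulrCA mulrC.
apply: ler_sum => m _; rewrite sum_mul_window_diff mulr_sumr.
(* A given window is increasing for [n.+1! / F] permutations. *)
rewrite -(sum_matches_const R 1 (@window_inj _ _ m)); apply: ler_sum => sigma _.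
rewrite -/(increasing_on m sigma); case: (boolP (increasing_on m sigma)).
  by move=> inc; rewrite mul1r; exact: key.
by rewrite mul0r mulr0.
Qed.

(** * Case distinction on the number of blocks *)

Theorem proposition4p6 (R : realType) (k : nat) (hk : (2 <= k)%N)
    (pi : 'S_k) (A : {set 'I_k.-1}) :
  exists2 C : R, 0 < C &
    exists n0 : nat, forall n : nat, (n0 <= n)%N ->
      C * n%:R ^+ (2 * num_blocks A - 1) <=
        unif_variance (fun sigma : 'S_n => (num_occurrences pi A sigma)%:R : R).
Proof.
case: k hk pi A => [|[|k]] // _ pi A.
(* [A] is the full set exactly when there is a single block. *)
case: (eqVneq A [set: 'I_k.+1]) => [->|A_neqT].
  exact: variance_one_block.
exact: variance_many_blocks A_neqT.
Qed.
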